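(* Let $p$ be a prime and $s,t\in\mathbb{N}$. Let $b_1(X),\ldots,b_t(X)\in\mathbb{F}_p[X]$ be monic, nonconstant, pairwise coprime polynomials. Let $L_1,\ldots,L_s\in\mathbb{F}_p((X^{-1}))$ be such that $1,L_1,\ldots,L_s$ are linearly independent over $\mathbb{F}_p(X)$. Let $(\boldsymbol{x}_n)_{n\ge0}$ be the $s$-dimensional digital Kronecker sequence determined by $L_1,\ldots,L_s$, and let $(\boldsymbol{y}_n)_{n\ge0}$ be the $t$-dimensional Halton sequence in bases $b_1(X),\ldots,b_t(X)$. Then the $(s+t)$-dimensional hybrid sequence $((\boldsymbol{x}_n,\boldsymbol{y}_n))_{n\ge0}$ is uniformly distributed in $[0,1)^{s+t}$.
   Context: Elements of $\mathbb{F}_p$ are identified with the integers $\{0,1,\ldots,p-1\}$. For an integer $n\ge0$ with base-$p$ expansion $n=n_0+n_1p+\cdots+n_rp^r$, put $n(X)=n_0+n_1X+\cdots+n_rX^r\in\mathbb{F}_p[X]$. For $L=\sum_{i=w}^\infty a_iX^{-i}\in\mathbb{F}_p((X^{-1}))$ the fractional part is $\{L\}=\sum_{i\ge\max(1,w)}a_iX^{-i}$. Digital Kronecker sequence: for $L\in\mathbb{F}_p((X^{-1}))$ the one-dimensional sequence $(x_n)_{n\ge0}$ is defined by writing $\{n(X)L\}=\sum_{i\ge1}c_iX^{-i}$ and setting $x_n=\sum_{i\ge1}c_ip^{-i}$; the $s$-dimensional digital Kronecker sequence determined by $L_1,\ldots,L_s$ has $n$-th point $(x_n^{(1)},\ldots,x_n^{(s)})$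 where $x_n^{(i)}$ is the $n$-th point of the one-dimensional sequence for $L_i$. Van der Corput sequence in base $b(X)$ (monic, nonconstant, degree $e$): write $n(X)=\sum_{i\ge0}a_i(X)b(X)^i$ with $\deg a_i<e$ and set $y_n=\sum_{i\ge0}a_i(p)p^{-e(i+1)}$ (where $a_i(p)$ is the integer obtained by substituting $X=p$). The Halton sequence in bases $b_1(X),\ldots,b_t(X)$ has $n$-th point whose $j$-th coordinate is the $n$-th point of the van der Corput sequence in base $b_j(X)$. A sequence $(\boldsymbol z_n)$ in $[0,1)^d$ is uniformly distributed if $\lim_{N\to\infty}D_N=0$, where $D_N=\sup_B|A_N(B)/N-\lambda(B)|$, the supremum over all axis-parallel boxes $B\subseteq[0,1)^d$, $A_N(B)=\#\{0\le n<N:\boldsymbol z_n\in B\}$, $\lambda$ Lebesgue measure. *)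

(* Defs.v *)
From HB Require Import structures.
From mathcomp Require Import all_boot all_order all_algebra.
From Stdlib Require Import Reals ZArith ClassicalEpsilon.

Set Implicit Arguments.
Unset Strict Implicit.
Unset Printing Implicit Defensive.

Import GRing.Theory.
Local Open Scope ring_scope.

(* A Laurent series L = sum_i a_i X^{-i} in F_p((X^{-1})), given by its
   coefficient function i |-> a_i (coefficient of X^{-i}), i : Z. *)
Definition laurent (p : nat) := Z -> 'F_p.

Definition is_laurent (p : nat) (L : laurent p) : Prop :=
  exists w : Z, forall i : Z, (i < w)%Z -> L i = 0.

Definition digit_poly (p n : nat) : {poly 'F_p} :=
  \poly_(i < n.+1) (modn (divn n (expn p i)) p)%:R.

Definition polyL_mul (p : nat) (q : {poly 'F_p}) (L : laurent p) : laurent p :=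
  fun i => \sum_(j < size q) q`_j * L (i + Z.of_nat j)%Z.

Definition poly_laurent (p : nat) (q : {poly 'F_p}) : laurent p :=
  fun i => if (i <=? 0)%Z then q`_(Z.to_nat (- i)) else 0.

(* 1, L_1, ..., L_s linearly independent over F_p(X)
   (coefficients written with a common denominator cleared) *)
Definition lin_indep_1L (p s : nat) (L : 'I_s -> laurent p) : Prop :=
  forall (q0 : {poly 'F_p}) (q : 'I_s -> {poly 'F_p}),
    (forall i : Z,
        poly_laurent q0 i + \sum_(k < s) polyL_mul (q k) (L k) i = 0) ->
    q0 = 0 /\ (forall k, q k = 0).

Definition kron_digit (p : nat) (L : laurent p) (n k : nat) : 'F_p :=
  polyL_mul (digit_poly p n) L (Z.of_nat k).

(* a_i(X) in n(X) = sum_i a_i(X) b(X)^i, deg a_i < deg b *)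
Definition vdc_digit (p : nat) (b : {poly 'F_p}) (n i : nat) : {poly 'F_p} :=
  (digit_poly p n %/ b ^+ i) %% b.

Definition poly_at_p (p : nat) (a : {poly 'F_p}) : nat :=
  \big[addn/0%nat]_(j < size a) muln (nat_of_ord a`_j) (expn p j).

Local Close Scope ring_scope.
Local Open Scope R_scope.

Definition series_val (u : nat -> R) : R :=
  epsilon (inhabits 0) (fun l => infinite_sum u l).

(* n-th point of the 1-dim digital Kronecker sequence for L:
   x_n = sum_{i>=1} c_i p^{-i}, {n(X) L} = sum_{i>=1} c_i X^{-i} *)
Definition kron_coord (p : nat) (L : laurent p) (n : nat) : R :=
  series_val (fun k =>
    (INR (nat_of_ord (kron_digit L n k.+1))
       / INR p ^ k.+1)).

(* n-th point of the van der Corput sequence in base b(X), e = deg b;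
   a_i = (n(X) div b^i) mod b; a_i = 0 for i > n since deg n(X) <= n *)
Definition vdc (p : nat) (b : {poly 'F_p}) (n : nat) : R :=
  let e := (size b).-1 in
  sum_f_R0 (fun i =>
    (INR (poly_at_p (vdc_digit b n i)) / INR p ^ (muln e i.+1))) n.

Definition hybrid (p s t : nat) (L : 'I_s -> laurent p) (b : 'I_t -> {poly 'F_p})
  (n : nat) (j : 'I_(s + t)) : R :=
  match fintype.split j with
  | inl k => kron_coord (L k) n
  | inr k => vdc (b k) n
  end.

Definition Rleb (x y : R) : bool := if Rle_dec x y then true else false.
Definition Rltb (x y : R) : bool := if Rlt_dec x y then true else false.

Definition in_interval (lc rc : bool) (a b x : R) : bool :=
  (if lc then Rleb a x else Rltb a x) && (if rc then Rleb x b else Rltb x b).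

Definition in_box (d : nat) (lc rc : 'I_d -> bool) (a b : 'I_d -> R)
  (x : 'I_d -> R) : bool :=
  [forall j, in_interval (lc j) (rc j) (a j) (b j) (x j)].

Definition count_box (d : nat) (z : nat -> 'I_d -> R) (N : nat)
  (lc rc : 'I_d -> bool) (a b : 'I_d -> R) : nat :=
  count (fun n => in_box lc rc a b (z n)) (iota 0 N).

Definition box_vol (d : nat) (a b : 'I_d -> R) : R :=
  foldr (fun j acc => ((b j - a j) * acc)) 1 (enum 'I_d).

(* lim_{N->oo} D_N = 0, with D_N = sup over axis-parallel boxes B in [0,1)^d
   of |A_N(B)/N - lambda(B)|, written out *)
Definition uniformly_distributed (d : nat) (z : nat -> 'I_d -> R) : Prop :=
  forall eps : R, (0 < eps) ->
  exists N0 : nat, forall N : nat, leq N0 N -> leq 1 N ->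
  forall (lc rc : 'I_d -> bool) (a b : 'I_d -> R),
    (forall j, 0 <= a j /\ a j <= b j /\ b j <= 1) ->
    (Rabs (INR (count_box z N lc rc a b) / INR N - box_vol a b) <= eps).

(* Main.v *)
From Stdlib Require Import Reals ZArith Lra Classical.
Require Import Defs.
From HB Require Import structures.
From mathcomp Require Import all_boot all_order all_algebra mxabelem zify.

Set Implicit Arguments.
Unset Strict Implicit.
Unset Printing Implicit Defensive.

Import GRing.Theory.
(* MathComp has rebound the delimiting key Z to its own integers. *)
Delimit Scope Z_scope with ZZ.

(* Choose [m] divisible by every [e_j = deg b_j] and cut each coordinate axis
   into [p^m] cells.  The cell of a point is given by the first [m] digits of
   each [{n(X) L_i}] and by [n(X)] modulo [B = prod_j b_j^(m/e_j)], a polynomial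
   of degree [t m].  Two indices of one block [[k p^(M+tm), (k+1) p^(M+tm))]
   with the same cell have digit polynomials differing by [B g] with
   [deg g < M], where all [s m] leading fractional digits of the [g B L_i]
   vanish.  These digits are linear forms in [g]; since [1, L_1, ..., L_s] are
   independent they are linearly independent for [M] large, so at most
   [p^(M-sm)] indices of a block share a cell.  As there are [p^(m(s+t))] cells,
   this is the exact average, so cells are hit evenly up to an error bounded by
   the block length, and boxes are squeezed between unions of cells. *)

(** * From evenly visited grids to uniform distribution *)

Lemma count_block (T : finType) (f : nat -> T) (K c : nat) (S : {set T}) :
  (forall k w, #|[set r : 'I_K | f (k * K + r)%N == w]| <= c)%N ->
  forall k, (count (fun n => f n \in S) (iota (k * K) K) <= c * #|S|)%N.
Proof.
move=> Hc k.
have -> : count (fun n => f n \in S) (iota (k * K) K)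
    = (\sum_(r < K) (f (k * K + r)%N \in S))%N.
  by rewrite -[in LHS](addn0 (k * K)) iotaDl count_map -sum1_count big_mkcond
    -[X in iota 0 X]subn0 big_mkord; apply: eq_bigr => r _ /=; case: (_ \in S).
have -> : (c * #|S| = \sum_(w in S) c)%N by rewrite sum_nat_const mulnC.
have E (r : 'I_K) : ((f (k * K + r)%N \in S) : nat)
    = (\sum_(w in S) (f (k * K + r)%N == w))%N.
  case: (boolP (_ \in S)) => h.
    by rewrite (bigD1 _ h) /= eqxx big1 // => w /andP[_ /negPf]; rewrite eq_sym => ->.
  by rewrite big1 // => w wS; case: eqP => // e; rewrite e wS in h.
rewrite (eq_bigr _ (fun r _ => E r)) exchange_big /=.
apply: leq_sum => w _; apply: leq_trans (Hc k w).
by rewrite -sum1_card [in X in (_ <= X)%N]big_mkcond; apply: leq_sum => r _; rewrite inE; case: eqP.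
Qed.

(** Rounding [N] up to whole blocks overcounts by at most one block; this is the source of the error
    [K / N] below. *)
Lemma count_patterns (T : finType) (f : nat -> T) (K c N : nat) (S : {set T}) :
  (0 < K)%N ->
  (forall k w, #|[set r : 'I_K | f (k * K + r)%N == w]| <= c)%N ->
  (count (fun n => f n \in S) (iota 0 N) <= (N %/ K).+1 * (c * #|S|))%N.
Proof.
move=> K0 Hc.
have Hq q : (count (fun n => f n \in S) (iota 0 (q * K)) <= q * (c * #|S|))%N.
  elim: q => [|q IH]; first by rewrite mul0n.
  rewrite mulSn addnC iotaD count_cat [in X in (_ <= X)%N]mulSn addnC.
  by apply: leq_add => //; apply: count_block.
apply: leq_trans (Hq _).
have le : (N <= (N %/ K).+1 * K)%N by rewrite ltnW // -ltn_divLR.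
by rewrite -(subnKC le) iotaD count_cat leq_addr.
Qed.

Local Open Scope R_scope.

Lemma RlebP x y : reflect (x <= y) (Rleb x y).
Proof. by rewrite /Rleb; case: Rle_dec => h; constructor. Qed.

Lemma RltbP x y : reflect (x < y) (Rltb x y).
Proof. by rewrite /Rltb; case: Rlt_dec => h; constructor. Qed.

Lemma leq_INR m n : (m <= n)%N -> INR m <= INR n.
Proof. by move=> /leP; apply: le_INR. Qed.

(** * Integers in real intervals *)

Lemma card_ord_count Q (P : pred nat) : #|[pred v : 'I_Q | P v]| = count P (iota 0 Q).
Proof. by rewrite cardE -val_enum_ord count_map size_filter enumT. Qed.

Lemma count_iotaS (P : pred nat) Q : count P (iota 0 Q.+1) = (count P (iota 0 Q) + P Q)%N.
Proof. by rewrite -addn1 iotaD count_cat /= addn0. Qed.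

(** The hypothesis keeps the bound nonnegative when the interval contains no integer; it is also
    what the induction needs after [y] has been lowered. *)
Lemma count_closed_interval Q x y : x <= y + 1 ->
  INR (count (fun v => Rleb x (INR v) && Rleb (INR v) y) (iota 0 Q)) <= y - x + 1.
Proof.
elim: Q y => [|Q IH] y xy; first by rewrite /=; lra.
rewrite count_iotaS plus_INR.
case: (RlebP x (INR Q)) => h1; last by rewrite /=; have := IH y xy; lra.
case: (RlebP (INR Q) y) => h2; last by rewrite /=; have := IH y xy; lra.
(* Since [Q] itself is counted, [y] may be lowered to [Q - 1] for the integers below [Q] without
   changing their count. *)
have := IH (INR Q - 1) ltac:(lra).
set c1 := count _ _; set c2 := count _ _ => H.
suff -> : c2 = c1 by rewrite /=; lra.
apply: eq_in_count => v; rewrite mem_iota add0n => /andP[_ vQ]; congr andb.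
have : INR v.+1 <= INR Q by apply: leq_INR.
by rewrite S_INR => ?; apply/RlebP/RlebP; lra.
Qed.

(** The hypotheses ensure that every integer strictly between [x] and [y] lies in the counted range
    [[0, Q)]. *)
Lemma count_open_interval Q x y : -1 <= x -> y <= INR Q ->
  y - x - 1 <= INR (count (fun v => Rltb x (INR v) && Rltb (INR v) y) (iota 0 Q)).
Proof.
move=> x1; elim: Q y => [|Q IH] y; first by rewrite /=; lra.
rewrite count_iotaS plus_INR S_INR => yQ.
case: (Rle_dec y (INR Q)) => h.
  by have := IH y h; have := pos_INR (Rltb x (INR Q) && Rltb (INR Q) y); lra.
case: (RltbP x (INR Q)) => h1; last first.
  by rewrite /=; have := pos_INR (count (fun v => Rltb x (INR v) && Rltb (INR v) y) (iota 0 Q)); lra.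
case: (RltbP (INR Q) y) => h2; last lra.
have := IH (INR Q) (Rle_refl _).
set c1 := count _ _; set c2 := count _ _ => H.
suff -> : c2 = c1 by rewrite /=; lra.
apply: eq_in_count => v; rewrite mem_iota add0n => /andP[_ vQ]; congr andb.
have : INR v.+1 <= INR Q by apply: leq_INR.
by rewrite S_INR => ?; apply/RltbP/RltbP; lra.
Qed.

(** Factors are exchanged one at a time. As all of them lie in [[0, 1]], each exchange costs at most
    [dl]; the bounds on the product are carried along for the induction. *)
Lemma foldr_prod_le (I : Type) (r : seq I) (x y : I -> R) (dl : R) :
  0 <= dl -> (forall i, 0 <= x i <= 1) -> (forall i, 0 <= y i <= 1) ->
  (forall i, x i <= y i + dl) ->
  0 <= foldr (fun i acc => x i * acc) 1 r <= 1 /\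
  foldr (fun i acc => x i * acc) 1 r
    <= foldr (fun i acc => y i * acc) 1 r + INR (size r) * dl.
Proof.
move=> dl0 Hx Hy Hxy; elim: r => [|i r [[IH1 IH2] IH3]]; first by rewrite /=; lra.
rewrite [size _]/= S_INR /=.
set X := foldr _ _ _ in IH1 IH2 IH3 *; set Y := foldr _ _ _ in IH3 *.
have nr := pos_INR (size r).
move: (Hx i) (Hy i) (Hxy i) => [? ?] [? ?] ?.
split; first by split; nra.
have : y i * X <= y i * (Y + INR (size r) * dl) by apply: Rmult_le_compat_l.
have : 0 <= INR (size r) * dl by apply: Rmult_le_pos.
nra.
Qed.

Lemma INR_expn a n : INR (expn a n) = INR a ^ n.
Proof. by elim: n => [|n IH] //; rewrite expnS mult_INR IH. Qed.

Lemma card_family_ratio (d Q : nat) (F : 'I_d -> pred 'I_Q) : (0 < Q)%N ->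
  INR #|family F| / INR (expn Q d)
   = foldr (fun j acc => INR #|F j| / INR Q * acc) 1 (enum 'I_d).
Proof.
move=> Q0.
have Q0' : INR Q <> 0 by apply: not_0_INR; lia.
rewrite card_family INR_expn -[X in _ ^ X](size_enum_ord d) /image_mem.
elim: (enum 'I_d) => [|j r IH]; first by rewrite /=; lra.
rewrite /= -IH mult_INR; have := pow_nonzero (INR Q) (size r) Q0'.
by move: (_ ^ _) (INR (foldr _ _ _)) (INR #|_|) => u v w u0; field.
Qed.

(** * Box discrepancy for a grid with bounded fibres *)

Section Grid.
Variables (d : nat) (z : nat -> 'I_d -> R) (Q K c : nat) (f : nat -> {ffun 'I_d -> 'I_Q}).
Hypotheses (Q0 : (0 < Q)%N) (K0 : (0 < K)%N).
Hypothesis f_cell : forall n j, INR (f n j) <= z n j * INR Q <= INR (f n j) + 1.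
Hypothesis f_fiber : forall k w, (#|[set r : 'I_K | f (k * K + r)%N == w]| <= c)%N.
Hypothesis cK : (c * Q ^ d = K)%N.

(** By [cK] the fibre bound [c] equals the average [K / Q ^ d], so the main term is exactly the
    density of [S], and the last, incomplete block costs at most [K / N]. *)
Lemma pattern_frequency_le N (S : {set {ffun 'I_d -> 'I_Q}}) : (0 < N)%N ->
  INR (count (fun n => f n \in S) (iota 0 N)) / INR N
   <= INR #|S| / INR (expn Q d) + INR K / INR N.
Proof.
move=> N0.
have H := count_patterns N S K0 f_fiber.
have {}H : (expn Q d * count (fun n => f n \in S) (iota 0 N) <= (N + K) * #|S|)%N.
  apply: leq_trans (leq_mul (leqnn _) H) _.
  have -> : (Q ^ d * ((N %/ K).+1 * (c * #|S|)) = ((N %/ K).+1 * K) * #|S|)%N.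
    by rewrite -[K in (_ * K * _)%N]cK mulnCA -!mulnA (mulnCA c).
  by rewrite leq_mul2r mulSn addnC leq_add2r leq_divM orbT.
have HS : (#|S| <= expn Q d)%N.
  by apply: leq_trans (max_card _) _; rewrite card_ffun !card_ord.
move/leq_INR: H; rewrite !mult_INR plus_INR.
move/leq_INR: HS.
have : 0 < INR N by apply: lt_0_INR; lia.
have : 0 < INR (expn Q d) by apply: lt_0_INR; have := expn_gt0 Q d; lia.
have := pos_INR #|S|; have := pos_INR K.
move: (INR #|_|) (INR K) (INR N) (INR (expn _ _)) (INR (count _ _)) => s k n q a k0 s0 q0 n0 sq H.
apply: (Rmult_le_reg_r (n * q)); first nra.
have -> : a / n * (n * q) = q * a by field; lra.
have -> : (s / q + k / n) * (n * q) = s * n + k * q by field; lra.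
nra.
Qed.

(* The upper bound for the complement. *)
Lemma pattern_frequency_ge N (S : {set {ffun 'I_d -> 'I_Q}}) : (0 < N)%N ->
  INR #|S| / INR (expn Q d) - INR K / INR N
   <= INR (count (fun n => f n \in S) (iota 0 N)) / INR N.
Proof.
move=> N0.
have H1 := pattern_frequency_le (~: S) N0.
have H2 : INR (count (fun n => f n \in S) (iota 0 N))
    + INR (count (fun n => f n \in ~: S) (iota 0 N)) = INR N.
  rewrite -plus_INR -[N in RHS](size_iota 0) -(count_predC (fun n => f n \in S)).
  by congr (INR (_ + _)); apply: eq_count => n /=; rewrite inE.
have H3 : INR #|S| + INR #|~: S| = INR (expn Q d).
  by rewrite -plus_INR -[X in INR X]/(#|S| + #|~: S|)%N cardsC card_ffun !card_ord.
have n0 : 0 < INR N by apply: lt_0_INR; lia.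
have q0 : 0 < INR (expn Q d) by apply: lt_0_INR; have := expn_gt0 Q d; lia.
move: H1 H2 H3; move: (INR #|S|) (INR #|~: S|) (INR (count _ _)) (INR (count _ _)).
move=> s1 s2 a b H1 H2 H3.
have -> : a / INR N = 1 - b / INR N by rewrite -H2; field; lra.
have -> : s1 / INR (expn Q d) = 1 - s2 / INR (expn Q d) by rewrite -H3; field; lra.
lra.
Qed.

Section Box.
Variables (a b : 'I_d -> R) (lc rc : 'I_d -> bool).
Hypothesis ab : forall j, 0 <= a j /\ a j <= b j /\ b j <= 1.

(** Cell [v] stands for the closed interval from [v / Q] to [(v + 1) / Q]. Outer cells meet
    [[a j, b j]]; inner cells lie in the open interval. Hence both choices serve for all values of
    [lc] and [rc]. *)
Definition outer_cells (j : 'I_d) : pred 'I_Q := fun v =>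
  Rleb (a j * INR Q - 1) (INR v) && Rleb (INR v) (b j * INR Q).
Definition inner_cells (j : 'I_d) : pred 'I_Q := fun v =>
  Rltb (a j * INR Q) (INR v) && Rltb (INR v) (b j * INR Q - 1).

Let Qpos : 0 < INR Q. Proof. by apply: lt_0_INR; lia. Qed.

Lemma count_box_le_outer N :
  (count_box z N lc rc a b
   <= count (fun n => f n \in [set g | g \in family outer_cells]) (iota 0 N))%N.
Proof.
apply: sub_count => n /= /forallP H; rewrite inE; apply/familyP => j.
have [f1 f2] := f_cell n j.
rewrite unfold_in /outer_cells; move: (H j); rewrite /in_interval => /andP[h1 h2].
have {}h1 : a j <= z n j by case: (lc j) h1 => [/RlebP|/RltbP]; lra.
have {}h2 : z n j <= b j by case: (rc j) h2 => [/RlebP|/RltbP]; lra.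
have k1 := Rmult_le_compat_r _ _ _ (Rlt_le _ _ Qpos) h1.
have k2 := Rmult_le_compat_r _ _ _ (Rlt_le _ _ Qpos) h2.
by move: f1 f2; move: (INR (f n j)) => v *; apply/andP; split; apply/RlebP; lra.
Qed.

Lemma inner_le_count_box N :
  (count (fun n => f n \in [set g | g \in family inner_cells]) (iota 0 N)
   <= count_box z N lc rc a b)%N.
Proof.
apply: sub_count => n /=; rewrite inE => /familyP H; apply/forallP => j.
have [f1 f2] := f_cell n j.
move: (H j); rewrite unfold_in /inner_cells => /andP[/RltbP h1 /RltbP h2].
have {}h1 : a j < z n j by apply: (Rmult_lt_reg_r (INR Q)) => //; apply: Rlt_le_trans f1.
have {}h2 : z n j < b j.
  apply: (Rmult_lt_reg_r (INR Q)) => //; apply: Rle_lt_trans f2 _.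
  by move: h2; move: (INR (f n j)) => v ?; lra.
by rewrite /in_interval; case: (lc j); case: (rc j); apply/andP; split;
  try (apply/RlebP; lra); apply/RltbP; lra.
Qed.

Lemma card_cells_ratio (F : 'I_d -> pred 'I_Q) j : 0 <= INR #|F j| / INR Q <= 1.
Proof.
have h1 := pos_INR #|F j|.
have : INR #|F j| <= INR Q by apply: leq_INR; rewrite -[Q in (_ <= Q)%N]card_ord max_card.
move=> h2; split; first by apply: Rle_mult_inv_pos.
by apply: (Rmult_le_reg_r (INR Q)) => //; rewrite /Rdiv Rmult_assoc Rinv_l; lra.
Qed.

(** The admissible [v] fill an interval of length [(b j - a j) * Q + 1], which holds at most one
    integer more than its length. The inner window is shorter by 2, and loses at most one
    integer. *)
Lemma outer_ratio j : INR #|outer_cells j| / INR Q <= (b j - a j) + 2 / INR Q.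
Proof.
have [a0 [a1 b1]] := ab j.
have := @count_closed_interval Q (a j * INR Q - 1) (b j * INR Q) ltac:(nra).
rewrite -card_ord_count; set C := #|_| => H.
apply: (Rmult_le_reg_r (INR Q)) => //.
rewrite Rmult_plus_distr_r /Rdiv !Rmult_assoc Rinv_l; last lra.
apply: Rle_trans (_ : INR C * 1 <= _); last by move: (INR C) H => v; lra.
by right; congr (INR _ * 1); apply: eq_card.
Qed.

Lemma inner_ratio j : b j - a j <= INR #|inner_cells j| / INR Q + 2 / INR Q.
Proof.
have [a0 [a1 b1]] := ab j.
have := @count_open_interval Q (a j * INR Q) (b j * INR Q - 1) ltac:(nra) ltac:(nra).
rewrite -card_ord_count; set C := #|_| => H.
apply: (Rmult_le_reg_r (INR Q)) => //.
rewrite Rmult_plus_distr_r /Rdiv !Rmult_assoc Rinv_l; last lra.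
apply: Rle_trans (_ : INR C * 1 + 2 * 1 <= _); first by move: (INR C) H => v; lra.
by right; congr (INR _ * 1 + _); apply: eq_card.
Qed.

(** The first error term comes from replacing each of the [d] sides by whole cells, the second from
    the incomplete block. Neither depends on the box, which gives uniformity. *)
Lemma count_box_discrepancy N : (0 < N)%N ->
  Rabs (INR (count_box z N lc rc a b) / INR N - box_vol a b)
   <= INR d * (2 / INR Q) + INR K / INR N.
Proof.
move=> N0.
have n0 : 0 < INR N by apply: lt_0_INR; lia.
have q2 : 0 <= 2 / INR Q by apply: Rle_mult_inv_pos; lra.
have ab1 j : 0 <= b j - a j <= 1 by have := ab j; lra.
have mono (x y : nat) : (x <= y)%N -> INR x / INR N <= INR y / INR N.
  by move/leq_INR=> h; apply: Rmult_le_compat_r => //; left; apply: Rinv_0_lt_compat.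
have O1 := mono _ _ (count_box_le_outer N).
have I1 := mono _ _ (inner_le_count_box N).
have O2 := pattern_frequency_le [set g | g \in family outer_cells] N0.
have I2 := pattern_frequency_ge [set g | g \in family inner_cells] N0.
rewrite cardsE card_family_ratio // in O2; rewrite cardsE card_family_ratio // in I2.
have [_ O3] := foldr_prod_le (enum 'I_d) q2 (card_cells_ratio outer_cells) ab1 outer_ratio.
have [_ I3] := foldr_prod_le (enum 'I_d) q2 ab1 (card_cells_ratio inner_cells) inner_ratio.
rewrite size_enum_ord in O3 I3.
have U : INR (count_box z N lc rc a b) / INR N
    <= box_vol a b + INR d * (2 / INR Q) + INR K / INR N.
  by apply: Rle_trans O1 (Rle_trans _ _ _ O2 _); apply: Rplus_le_compat_r O3.
have L : box_vol a b - INR d * (2 / INR Q) - INR K / INR N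
    <= INR (count_box z N lc rc a b) / INR N.
  apply: Rle_trans I1; apply: Rle_trans I2; apply: Rplus_le_compat_r.
  apply/(Rplus_le_reg_r (INR d * (2 / INR Q))).
  by rewrite /Rminus Rplus_assoc Rplus_opp_l Rplus_0_r; apply: I3.
apply: Rabs_le; split; lra.
Qed.
End Box.
End Grid.

Lemma uniformly_distributed_of_grids d (z : nat -> 'I_d -> R) :
  (forall Q0 : nat, exists Q K c : nat, exists f : nat -> {ffun 'I_d -> 'I_Q},
    [/\ (Q0 < Q)%N, (0 < K)%N, (c * Q ^ d = K)%N,
      forall n j, INR (f n j) <= z n j * INR Q <= INR (f n j) + 1
    & forall k w, (#|[set r : 'I_K | f (k * K + r)%N == w]| <= c)%N]) ->
  uniformly_distributed z.
Proof.
move=> H eps eps0.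
(* The grid is fixed first, so that the term with [d] is at most [eps / 2]; only then is [N0]
   chosen, since it depends on the block length [K] of that grid. *)
have [Q0 HQ0] := INR_archimed eps (INR d * 4) eps0.
have [Q [K [c [f [QQ0 K0 cK f_cell f_fiber]]]]] := H Q0.
have [N0 HN0] := INR_archimed eps (INR K * 2) eps0.
exists N0 => N NN0 N1 lc rc a b ab.
apply: Rle_trans (count_box_discrepancy _ K0 f_cell f_fiber cK lc rc ab N1) _; first lia.
have q0 : 0 < INR Q by apply: lt_0_INR; lia.
have n0 : 0 < INR N by apply: lt_0_INR; lia.
have {}NN0 := leq_INR NN0; have {}QQ0 := leq_INR (ltnW QQ0).
suff [h1 h2] : INR d * (2 / INR Q) <= eps / 2 /\ INR K / INR N <= eps / 2 by lra.
split.
  apply: (Rmult_le_reg_r (INR Q)) => //.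
  by have -> : INR d * (2 / INR Q) * INR Q = INR d * 2; [field; lra | nra].
apply: (Rmult_le_reg_r (INR N)) => //.
by have -> : INR K / INR N * INR N = INR K; [field; lra | nra].
Qed.

Local Close Scope R_scope.

(** * Digit expansions *)

(* The first digit is the most significant one. *)
Fixpoint digits_val (u : nat -> nat) (B l : nat) : nat :=
  if l is l'.+1 then (digits_val u B l' * B + u l')%N else 0%N.

Lemma digits_val_lt u B l : (forall i, (u i < B)%N) -> (digits_val u B l < B ^ l)%N.
Proof.
move=> uB; elim: l => [|l IH] //=; rewrite expnSr.
apply: leq_trans (_ : (digits_val u B l).+1 * B <= _)%N; last by rewrite leq_mul2r IH orbT.
by rewrite mulSn addnC -addSn leq_add2r.
Qed.

Lemma digits_val_inj u v B l : (forall i, (u i < B)%N) -> (forall i, (v i < B)%N) ->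
  digits_val u B l = digits_val v B l -> forall i, (i < l)%N -> u i = v i.
Proof.
move=> uB vB; elim: l => [|l IH] //= E.
have B0 : (0 < B)%N by apply: leq_ltn_trans (uB 0%N).
have E2 : u l = v l.
  by move/(f_equal (modn^~ B)): E; rewrite !modnMDl !modn_small.
move: E; rewrite E2 => /addIn /eqP; rewrite eqn_pmul2r // => /eqP /IH {}IH i.
by rewrite ltnS leq_eqVlt => /orP[/eqP -> //|]; apply: IH.
Qed.

(** The [k] additional digits contribute an integer below [B ^ k]. *)
Lemma digits_val_cat u B l k : (forall i, (u i < B)%N) ->
  (digits_val u B l * B ^ k <= digits_val u B (l + k)
     < (digits_val u B l).+1 * B ^ k)%N.
Proof.
move=> uB; elim: k => [|k /andP[IH1 IH2]]; first by rewrite addn0 !muln1 leqnn ltnSn.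
rewrite addnS /= expnSr !mulnA; apply/andP; split.
  by apply: leq_trans (leq_addr _ _); rewrite leq_mul2r IH1 orbT.
apply: leq_trans (_ : (digits_val u B (l + k)).+1 * B <= _)%N; last by rewrite leq_mul2r IH2 orbT.
by rewrite mulSn addnC -addSn leq_add2r.
Qed.

Local Open Scope R_scope.

Definition digit_term (u : nat -> nat) (B i : nat) : R := INR (u i) / INR B ^ i.+1.

Lemma digit_sum_eq u B n : (0 < B)%N ->
  sum_f_R0 (digit_term u B) n * INR B ^ n.+1 = INR (digits_val u B n.+1).
Proof.
move=> B0; have B0' : INR B <> 0 by apply: not_0_INR; lia.
elim: n => [|n IH].
  by rewrite /= /digit_term /= mul0n add0n; field.
rewrite tech5 Rmult_plus_distr_r /digit_term.
rewrite [digits_val _ _ n.+2]/= plus_INR mult_INR -/(digits_val _ _ n.+1) -IH.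
rewrite -/(digit_term u B) [INR B ^ n.+2]/=.
have := pow_nonzero (INR B) n B0'; move: (INR B) B0' => b b0 bn.
rewrite /=; field; split=> //.
Qed.

Lemma digit_sum_bounds u B l n : (forall i, (u i < B)%N) -> (l <= n.+1)%N ->
  INR (digits_val u B l) <= sum_f_R0 (digit_term u B) n * INR (expn B l)
    <= INR (digits_val u B l) + 1.
Proof.
move=> uB ln; have B0 : (0 < B)%N by apply: leq_ltn_trans (uB 0%N).
have B0' : 0 < INR B by apply: lt_0_INR; lia.
have := digits_val_cat l (n.+1 - l) uB; rewrite subnKC // => /andP[/leq_INR h1 /ltnW /leq_INR h2].
have E : INR B ^ n.+1 = INR (expn B l) * INR (expn B (n.+1 - l)).
  by rewrite -mult_INR multE -expnD subnKC // INR_expn.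
rewrite -digit_sum_eq // E !mult_INR in h1 h2; rewrite S_INR in h2.
have P : 0 < INR (expn B (n.+1 - l)) by rewrite INR_expn; apply: pow_lt.
move: P h1 h2.
move: (sum_f_R0 _ _) (INR (expn B l)) (INR (expn _ _)) (INR (digits_val _ _ _)) => S x y v P h1 h2.
split; apply: (Rmult_le_reg_r y) => //; lra.
Qed.

(** The partial sums increase and are bounded, so the value picked by [epsilon] is their limit, to
    which the bounds for finite sums pass. The upper bound is not strict: all later digits may equal
    [B - 1]. *)
Lemma digit_series_bounds u B l : (forall i, (u i < B)%N) ->
  INR (digits_val u B l) <= series_val (digit_term u B) * INR (expn B l)
    <= INR (digits_val u B l) + 1.
Proof.
move=> uB; have B0 : (0 < B)%N by apply: leq_ltn_trans (uB 0%N).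
have B0' : 0 < INR B by apply: lt_0_INR; lia.
have BX k : 0 < INR (expn B k) by rewrite INR_expn; apply: pow_lt.
have grow : Un_growing (sum_f_R0 (digit_term u B)).
  move=> n; rewrite tech5; suff : 0 <= digit_term u B n.+1 by lra.
  by apply: Rle_mult_inv_pos; [apply: pos_INR | apply: pow_lt].
have [x Hx] : exists x, infinite_sum (digit_term u B) x.
  have [|x Hx] := growing_cv (sum_f_R0 (digit_term u B)) grow; last by exists x.
  (* With no leading digits, [l = 0], the bounds say that a partial sum is at most 1. *)
  exists 1 => x [n ->].
  by have := @digit_sum_bounds u B 0 n uB isT; rewrite /= Rmult_1_r; lra.
have {}Hx : Un_cv (sum_f_R0 (digit_term u B)) (series_val (digit_term u B)).
  exact: (ClassicalEpsilon.epsilon_spec (inhabits 0) _ (ex_intro _ x Hx)).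
move: (series_val _) Hx => y Hy; split.
  apply: Rle_trans (proj1 (digit_sum_bounds uB (leqnSn l))) _.
  apply: Rmult_le_compat_r; first by left.
  exact: growing_ineq.
have C : Un_cv (fun _ => (INR (digits_val u B l) + 1) / INR (expn B l))
    ((INR (digits_val u B l) + 1) / INR (expn B l)).
  by move=> eps e0; exists 0%N => n _; rewrite /Rdist Rminus_diag Rabs_R0.
have : y <= (INR (digits_val u B l) + 1) / INR (expn B l).
  apply: (Rle_cv_lim _ Hy C) => n.
  (* The bounds require at least [l] terms, so the [n]-th partial sum is compared with the one at
     [l + n]. *)
  have [_] := digit_sum_bounds uB (leq_trans (leqnSn l) (leq_addr n _)).
  move=> H.
  apply: Rle_trans (_ : sum_f_R0 (digit_term u B) (l + n) <= _).
    by apply: tech9 => //; lia.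
  apply: (Rmult_le_reg_r (INR (expn B l))) => //.
  by rewrite /Rdiv Rmult_assoc Rinv_l; [rewrite Rmult_1_r | have := BX l; lra].
move=> /(Rmult_le_compat_r _ _ _ (Rlt_le _ _ (BX l))).
by rewrite /Rdiv Rmult_assoc Rinv_l; [lra | have := BX l; lra].
Qed.

Local Close Scope R_scope.

Lemma eq_digits_val u v B l : (forall i, (i < l)%N -> u i = v i) ->
  digits_val u B l = digits_val v B l.
Proof.
elim: l => [|l IH] E //=; rewrite E // IH // => i il.
by apply: E; rewrite ltnW.
Qed.

(** Links the two digit orders: [poly_at_p] gives position [j] the weight [p ^ j], while
    [digits_val] starts from the most significant digit. *)
Lemma digits_val_rev u B e :
  digits_val (fun i => u (e.-1 - i)%N) B e = (\sum_(j < e) u j * B ^ j)%N.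
Proof.
elim: e u => [|e IH] u /=; first by rewrite big_ord0.
rewrite subnn big_ord_recl muln1 addnC; congr (_ + _)%N.
rewrite mulnC (@eq_digits_val _ (fun i => u (e.-1 - i).+1)).
  rewrite (IH (fun j => u j.+1)) big_distrr /=; apply: eq_bigr => j _.
  by rewrite /bump add1n expnS mulnCA.
by move=> i ie; congr u; lia.
Qed.

(** * Counting indices of a block with a common cell *)

Local Open Scope ring_scope.

(** The hypothesis compares digits in base [b]. If [b ^+ l] divides [q - r], the quotient modulo [b]
    is the difference of the digits at [l], because division with remainder by a fixed polynomial is
    additive. *)
Lemma modp_dvdp_exp (F : fieldType) (b q r : {poly F}) l :
  (forall i, (i < l)%N -> (q %/ b ^+ i) %% b = (r %/ b ^+ i) %% b) ->
  b ^+ l %| q - r.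
Proof.
elim: l => [|l IH] E; first by rewrite expr0 dvd1p.
have /modp_eq0P D0 := IH (fun i il => E i (ltnW il)).
rewrite (divp_eq (q - r) (b ^+ l)) D0 addr0 exprS dvdp_mul //.
by apply/modp_eq0P; rewrite divpD divpN modpD modpN E // subrr.
Qed.

Lemma dvdp_prod_coprime (F : fieldType) (I : finType) (f : I -> {poly F}) q :
  (forall i j, i != j -> coprimep (f i) (f j)) -> (forall i, f i %| q) ->
  \prod_i f i %| q.
Proof.
move=> cf df.
suff H r : uniq r -> \prod_(i <- r) f i %| q by apply: H; exact: index_enum_uniq.
elim: r => [|i r IH] /=; first by rewrite big_nil dvd1p.
case/andP=> ir /IH {}IH; rewrite big_cons Gauss_dvdp ?df //.
elim: r ir {IH} => [|j r IH]; first by rewrite big_nil coprimep1.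
by rewrite inE negb_or big_cons coprimepMr => /andP[/cf -> /IH].
Qed.

(** * Digit polynomials and products with Laurent series *)

Section Poly.
Variable p : nat.
Hypothesis p_pr : prime p.
Let p_gt1 : (1 < p)%N := prime_gt1 p_pr.
Let p_gt0 : (0 < p)%N := prime_gt0 p_pr.
Implicit Types (q g : {poly 'F_p}) (L : laurent p).

Lemma ltn_Fp (x : 'F_p) : (x < p)%N.
Proof. by rewrite -[X in (_ < X)%N](Fp_cast p_pr). Qed.

Lemma coef_digit_poly n i : (digit_poly p n)`_i = ((n %/ p ^ i) %% p)%N%:R.
Proof.
rewrite coef_poly; case: ltnP => // ni.
by rewrite divn_small ?mod0n //; apply: leq_trans (ltn_expl i p_gt1); rewrite ltnS ltnW.
Qed.

Lemma digit_poly_inj : injective (digit_poly p).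
Proof.
move=> n; elim/ltn_ind: n => n IH n' E.
have Ed i : (n %/ p ^ i = n' %/ p ^ i %[mod p])%N.
  have := f_equal (fun q : {poly 'F_p} => nat_of_ord q`_i) E.
  by rewrite /= !coef_digit_poly !val_Fp_nat // !modn_mod.
case: (posnP n) => [n0|n0].
  case: (posnP n') => [->//|n'0].
  (* The leading digit of [n'] is nonzero, whereas all digits of [n = 0] vanish. *)
  have := trunc_log_bounds p_gt1 n'0 => /andP[h1 h2].
  have := Ed (trunc_log p n'); rewrite n0 div0n mod0n modn_small.
    by move/esym/eqP; rewrite -leqn0 leqNgt divn_gt0 ?expn_gt0 ?p_gt0 // h1.
  by rewrite ltn_divLR ?expn_gt0 ?p_gt0 // -expnS.
have E1 : (n %/ p = n' %/ p)%N.
  apply: IH; first by rewrite ltn_Pdiv.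
  apply/polyP => i; rewrite !coef_digit_poly -!divnMA -expnS.
  by rewrite Ed.
by rewrite (divn_eq n p) (divn_eq n' p) E1; have := Ed 0%N; rewrite !divn1 => ->.
Qed.

(** From position [M] on, both indices carry the digits of [k]. *)
Lemma size_digit_poly_block k M r r' : (r < p ^ M)%N -> (r' < p ^ M)%N ->
  (size (digit_poly p (k * p ^ M + r)%N - digit_poly p (k * p ^ M + r')%N)%R <= M)%N.
Proof.
move=> rM r'M; apply/leq_sizeP => i Mi.
rewrite coefB !coef_digit_poly -(subnKC Mi) expnD !divnMA !divnMDl ?expn_gt0 ?p_gt0 //.
by rewrite !(divn_small rM, divn_small r'M) subrr.
Qed.

Lemma poly_at_pE q e : (size q <= e)%N ->
  poly_at_p q = digits_val (fun i => nat_of_ord q`_(e.-1 - i)) p e.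
Proof.
move=> qe; rewrite (digits_val_rev (fun j => nat_of_ord q`_j)) /poly_at_p.
rewrite (big_ord_widen _ (fun j => nat_of_ord (q`_j)%R * p ^ j)%N qe) big_mkcond /=.
apply: eq_bigr => j _; case: ltnP => // h.
by rewrite nth_default.
Qed.

Lemma poly_at_p_lt q e : (size q <= e)%N -> (poly_at_p q < p ^ e)%N.
Proof. by move=> /poly_at_pE ->; apply: digits_val_lt => i; apply: ltn_Fp. Qed.

Lemma poly_at_p_inj q g e : (size q <= e)%N -> (size g <= e)%N ->
  poly_at_p q = poly_at_p g -> q = g.
Proof.
move=> qe ge; rewrite !(@poly_at_pE _ e) // => /digits_val_inj H.
apply/polyP => i; case: (ltnP i e) => ie; last by rewrite !nth_default //; apply: leq_trans ie.
apply/val_inj => /=.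
have := H (fun i => ltn_Fp _) (fun i => ltn_Fp _) (e.-1 - i)%N.
have -> : (e.-1 - (e.-1 - i) = i)%N by lia.
by apply; lia.
Qed.

Lemma polyL_mulE q L i n : (size q <= n)%N ->
  polyL_mul q L i = \sum_(j < n) q`_j * L (i + Z.of_nat j)%ZZ.
Proof.
move=> qn; rewrite /polyL_mul (big_ord_widen _ (fun j => q`_j * L (i + Z.of_nat j)%ZZ) qn).
rewrite big_mkcond /=; apply: eq_bigr => j _; case: ltnP => // h.
by rewrite nth_default // mul0r.
Qed.

Lemma polyL_mulDZ a q g L i :
  polyL_mul (a *: q + g) L i = a * polyL_mul q L i + polyL_mul g L i.
Proof.
pose n := maxn (size q) (size g).
have h1 : (size q <= n)%N by apply: leq_maxl.
have h2 : (size g <= n)%N by apply: leq_maxr.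
have h3 : (size (a *: q + g)%R <= n)%N.
  apply: leq_trans (size_polyD _ _) _; rewrite geq_max h2 andbT.
  by apply: leq_trans (size_scale_leq _ _) _.
rewrite !(@polyL_mulE _ _ _ n) // mulr_sumr -big_split; apply: eq_bigr => j _ /=.
by rewrite coefD coefZ mulrDl mulrA.
Qed.

Lemma polyL_mul0 L i : polyL_mul 0 L i = 0.
Proof. by rewrite (@polyL_mulE _ _ _ 0) ?size_poly0 // big_ord0. Qed.

Lemma polyL_mulB q g L i : polyL_mul (q - g) L i = polyL_mul q L i - polyL_mul g L i.
Proof. by rewrite addrC -scaleN1r polyL_mulDZ mulN1r addrC. Qed.

Lemma polyL_mul_sum (I : Type) (r : seq I) (a : I -> 'F_p) (q : I -> {poly 'F_p}) L i :
  polyL_mul (\sum_(j <- r) a j *: q j) L i = \sum_(j <- r) a j * polyL_mul (q j) L i.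
Proof.
elim: r => [|j r IH]; first by rewrite !big_nil polyL_mul0.
by rewrite !big_cons polyL_mulDZ IH.
Qed.

Lemma polyL_mulXn q j L i : polyL_mul (q * 'X^j) L i = polyL_mul q L (i + Z.of_nat j)%ZZ.
Proof.
have sz : (size (q * 'X^j)%R <= j + size q)%N.
  by apply: leq_trans (size_polyMleq _ _) _; rewrite size_polyXn; lia.
rewrite (polyL_mulE _ _ sz) big_split_ord /= big1 ?add0r.
  apply: eq_bigr => l _; rewrite coefMXn /= ltnNge leq_addr /= addKn.
  by congr (_ * L _); lia.
by move=> l _; rewrite coefMXn ltn_ord mul0r.
Qed.

(** Multiplication by ['X^j] shifts the coefficients by [j]. Thus each coefficient of the product
    with [L] is a linear form in the coefficients of [g]. *)
Lemma polyL_mulM q g L i M : (size g <= M)%N ->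
  polyL_mul (q * g) L i = \sum_(j < M) g`_j * polyL_mul q L (i + Z.of_nat j)%ZZ.
Proof.
move=> gM; have -> : g = \sum_(j < M) g`_j *: 'X^j.
  rewrite -poly_def; apply/polyP => j; rewrite coef_poly.
  by case: ltnP => // h; rewrite nth_default //; apply: leq_trans h.
rewrite mulr_sumr.
under eq_bigr => j _ do rewrite -scalerAr.
rewrite polyL_mul_sum; apply: eq_bigr => j _; rewrite polyL_mulXn.
by rewrite -poly_def coef_poly ltn_ord.
Qed.

Lemma polyL_mul_laurent q L : is_laurent L ->
  exists n : nat, forall i, (i < - Z.of_nat n)%ZZ -> polyL_mul q L i = 0.
Proof.
case=> w Hw; exists (size q + Z.to_nat (Z.abs w))%N => i Hi.
rewrite /polyL_mul big1 // => j _; rewrite Hw ?mulr0 //.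
by have := ltn_ord j; lia.
Qed.

(** A combination of the [L i] without fractional part is a polynomial, its degree being bounded by
    [is_laurent]. Taking the negative of this polynomial as [q0] gives a relation to which
    independence applies. *)
Lemma lin_indep_frac s (L : 'I_s -> laurent p) (h : 'I_s -> {poly 'F_p}) :
  (forall k, is_laurent (L k)) -> lin_indep_1L L ->
  (forall k : nat, \sum_i polyL_mul (h i) (L i) (Z.of_nat k.+1) = 0) ->
  forall i, h i = 0.
Proof.
move=> Llau Lind H.
have [w Hw] := fin_all_exists (fun i => polyL_mul_laurent (h i) (Llau i)).
pose W := (\max_i w i)%N.
pose f i := \sum_k polyL_mul (h k) (L k) i.
have f0 i : (i < - Z.of_nat W)%ZZ -> f i = 0.
  move=> iW; rewrite /f big1 // => k _; apply: Hw.
  by have : (w k <= W)%N := leq_bigmax k; lia.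
apply: (proj2 (Lind (- \poly_(j < W.+1) f (- Z.of_nat j)%ZZ) h _)) => i.
 rewrite -/(f i) /poly_laurent; case: Z.leb_spec => i0; last first.
  by rewrite add0r -(H (Z.to_nat i).-1); congr f; lia.
rewrite coefN coef_poly; case: ltnP => iW.
  by rewrite (_ : - Z.of_nat (Z.to_nat (- i)) = i)%ZZ ?addNr //; lia.
by rewrite oppr0 add0r f0 //; lia.
Qed.

(** * The linear system for the leading fractional digits *)

Section System.
Variables (s m : nat) (L : 'I_s -> laurent p) (b : {poly 'F_p}).
Hypotheses (Llau : forall k, is_laurent (L k)) (Lind : lin_indep_1L L) (b0 : b != 0).

(* A row vector [g], read as a polynomial, is sent to the fractional digits
   of [g b L_i] up to [X^-m]. *)
Definition digit_mx M : 'M['F_p]_(M, s * m) :=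
  \matrix_(j < M) mxvec (\matrix_(i < s, k < m)
    polyL_mul b (L i) (Z.of_nat k.+1 + Z.of_nat j)%ZZ).

(** The entries depend only on [k + j], as in a Hankel matrix. So, reading row [i] of [W] as a
    polynomial [g i], the sum is the coefficient of [X^-(j+1)] in the sum of the [b * g i * L i]. If
    it vanished for all [j], independence would make every [b * g i], hence [W], zero. *)
Lemma digit_functional_neq0 (W : 'M['F_p]_(s, m)) : W != 0 -> exists j : nat,
  \sum_i \sum_k W i k * polyL_mul b (L i) (Z.of_nat k.+1 + Z.of_nat j)%ZZ != 0.
Proof.
move=> W0; apply: NNPP => /not_ex_all_not H; move/eqP: W0; apply.
pose g i := \poly_(k < m) (if insub k is Some k' then W i k' else 0).
have gE i (k : 'I_m) : (g i)`_k = W i k.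
  by rewrite coef_poly ltn_ord valK.
have G : forall i, b * g i = 0.
  apply: (@lin_indep_frac s L) => // j.
  have /negP/negPn/eqP Hj := H j; rewrite -[RHS]Hj.
  apply: eq_bigr => i _; rewrite (@polyL_mulM _ _ _ _ m) ?size_poly //.
  apply: eq_bigr => k _; rewrite gE; congr (_ * polyL_mul _ _ _); lia.
apply/matrixP => i k; rewrite mxE -gE.
by have /eqP := G i; rewrite mulf_eq0 (negPf b0) => /eqP ->; rewrite coef0.
Qed.

Lemma big_mxvec_index (F : 'I_(s * m) -> 'F_p) :
  \sum_x F x = \sum_i \sum_k F (mxvec_index i k).
Proof.
rewrite pair_bigA (reindex _ (curry_mxvec_bij s m)) /=.
by apply: eq_bigr => -[].
Qed.

(** There are finitely many [W] over the finite field, so one [M] exceeds a detecting index [j] for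
    each nonzero [W]; no nontrivial combination of the columns is then zero. *)
Lemma digit_mx_full : exists M, row_full (digit_mx M).
Proof.
(* The condition [W != 0] is put inside the existential so that an index can be chosen for every
   [W], with 0 as the default. *)
have H (W : 'M['F_p]_(s, m)) : exists j : nat, W != 0 ->
    \sum_i \sum_k W i k * polyL_mul b (L i) (Z.of_nat k.+1 + Z.of_nat j)%ZZ != 0.
  case: (eqVneq W 0) => [->|/digit_functional_neq0 [j Hj]]; last by exists j.
  by exists 0%N.
have [f Hf] := fin_all_exists H.
exists (\max_W f W).+1.
have : row_free (digit_mx (\max_W f W).+1)^T.
  apply: inj_row_free => v v0.
  apply/eqP; rewrite -(vec_mxK v) mxvec_eq0; apply/negPn/negP => W0.
  have /negP := Hf _ W0; apply; apply/eqP.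
  have jM : (f (vec_mx v) < (\max_W f W).+1)%N by rewrite ltnS leq_bigmax.
  have /matrixP/(_ 0 (Ordinal jM)) := v0; rewrite [in RHS]mxE => E.
  rewrite -[RHS]E mxE big_mxvec_index; apply: eq_bigr => i _; apply: eq_bigr => k _.
  by rewrite !mxE mxvecE !mxE.
by rewrite /row_free -col_leq_rank mxrank_tr => /eqP ->.
Qed.

Lemma card_digit_mx_kernel M : row_full (digit_mx M) ->
  #|[set g : 'rV['F_p]_M | g *m digit_mx M == 0]| = (p ^ (M - s * m))%N.
Proof.
move=> /eqP rk; transitivity #|rowg (kermx (digit_mx M))|.
  by apply: eq_card => g; rewrite !inE (sameP eqP sub_kermxP).
by rewrite card_rowg mxrank_ker rk card_Fp.
Qed.

(** Fix [r0] in [S]. Each difference [D r] is [b] times a quotient with at most [M] coefficients,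
    because [b] has degree [e]. The quotient lies in the kernel of [digit_mx] and determines [r], as
    digit polynomials are injective. *)
Lemma card_block_le M e k (S : {set 'I_(p ^ (M + e))}) :
  row_full (digit_mx M) -> size b = e.+1 ->
  {in S &, forall r r' : 'I_(p ^ (M + e)), let D := digit_poly p (k * p ^ (M + e) + r)%N
                                 - digit_poly p (k * p ^ (M + e) + r')%N in
     b %| D /\ forall i (l : 'I_m), polyL_mul D (L i) (Z.of_nat l.+1) = 0} ->
  (#|S| <= p ^ (M - s * m))%N.
Proof.
move=> full sb HS; rewrite -card_digit_mx_kernel //.
have [->|[r0 r0S]] := set_0Vmem S; first by rewrite cards0.
pose D (r : 'I_(p ^ (M + e))) : {poly 'F_p} := digit_poly p (k * p ^ (M + e) + r)%N
   - digit_poly p (k * p ^ (M + e) + r0)%N.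
pose g r : 'rV['F_p]_M := \row_j (D r %/ b)`_j.
have sg r : (size (D r %/ b)%R <= M)%N.
  rewrite size_divp // sb /= leq_subLR addnC.
  exact: size_digit_poly_block.
have g_inj : {in S &, injective g}.
  move=> r r' rS r'S E.
  have Eq : D r %/ b = D r' %/ b.
    apply/polyP => j; case: (ltnP j M) => jM; last by rewrite !nth_default //; apply: leq_trans jM.
    by have /matrixP/(_ 0 (Ordinal jM)) := E; rewrite !mxE.
  have [/divpK DE _] := HS _ _ rS r0S; have [/divpK DE' _] := HS _ _ r'S r0S.
  have : D r = D r' by rewrite /D -DE -DE' -/(D r) -/(D r') Eq.
  by move=> /addIr /digit_poly_inj /addnI /val_inj.
rewrite -(card_in_imset g_inj); apply: subset_leq_card.
apply/subsetP => _ /imsetP [r rS ->]; rewrite inE; apply/eqP.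
have [/divpK DE D0] := HS _ _ rS r0S.
apply/rowP => x; have [i [l ->]] : exists i l, x = mxvec_index i l.
  by case/mxvec_indexP: x => i l; exists i, l.
rewrite mxE [RHS]mxE -[RHS](D0 i l) -DE mulrC (polyL_mulM _ _ _ (sg r)).
by apply: eq_bigr => j _; rewrite !mxE mxvecE !mxE.
Qed.

End System.
End Poly.

Local Close Scope ring_scope.
Local Open Scope R_scope.

(** * The hybrid sequence *)

Lemma size_vdc_digit p (b : {poly 'F_p}) n i : prime p -> (1 < size b)%N ->
  (size (vdc_digit b n i) <= (size b).-1)%N.
Proof.
move=> p_pr b1; have b0 : b != 0%R by rewrite -size_poly_gt0; lia.
by rewrite -ltnS prednK ?ltn_modp //; lia.
Qed.

(** The power [b ^+ i] has degree at least [i], which exceeds the degree of the digit polynomial of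
    [n]. *)
Lemma vdc_digit_eq0 p (b : {poly 'F_p}) n i : (1 < size b)%N -> (n < i)%N ->
  poly_at_p (vdc_digit b n i) = 0%N.
Proof.
move=> b1 ni; rewrite /vdc_digit divp_small; first by rewrite mod0p /poly_at_p size_poly0 big_ord0.
apply: leq_ltn_trans (size_poly _ _) _.
by rewrite -ltn_predRL size_exp (leq_trans ni) // leq_pmull // ltn_predRL.
Qed.

Lemma vdc_bounds p (b : {poly 'F_p}) n l : prime p -> (1 < size b)%N ->
  let V := digits_val (fun i => poly_at_p (vdc_digit b n i)) (expn p (size b).-1) l in
  INR V <= vdc b n * INR (expn (expn p (size b).-1) l) <= INR V + 1.
Proof.
move=> p_pr b1 V.
have lt i : (poly_at_p (vdc_digit b n i) < expn p (size b).-1)%N.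
  by apply: poly_at_p_lt => //; apply: size_vdc_digit.
(* The sum defining [vdc] stops at [n]. Padding it with zero digits up to [n + l] supplies the [l]
   digits required by [digit_sum_bounds]. *)
have -> : vdc b n = sum_f_R0 (digit_term (fun i => poly_at_p (vdc_digit b n i))
    (expn p (size b).-1)) (n + l)%N.
  have T i : INR (poly_at_p (vdc_digit b n i)) / INR p ^ ((size b).-1 * i.+1)%N
      = digit_term (fun i => poly_at_p (vdc_digit b n i)) (expn p (size b).-1) i.
    by rewrite /digit_term INR_expn -pow_mult.
  rewrite /vdc; cbv zeta; elim: l {V} => [|l IH].
    by rewrite addn0; apply: PartSum.sum_eq => i _; apply: T.
  rewrite addnS tech5 -IH /digit_term vdc_digit_eq0 //; last by rewrite ltnS leq_addr.
  by rewrite /Rdiv Rmult_0_l Rplus_0_r.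
by apply: digit_sum_bounds => //; rewrite leqW ?leq_addl.
Qed.

Lemma kron_bounds p (L : laurent p) n m : prime p ->
  let V := digits_val (fun i => nat_of_ord (kron_digit L n i.+1)) p m in
  INR V <= kron_coord L n * INR (expn p m) <= INR V + 1.
Proof.
by move=> p_pr; apply: digit_series_bounds => i; apply: ltn_Fp.
Qed.

Local Close Scope R_scope.

Lemma size_prod_exp (F : fieldType) t (b : 'I_t -> {poly F}) (l : 'I_t -> nat) m :
  (forall j, b j != 0%R) -> (forall j, (size (b j)).-1 * l j = m)%N ->
  size (\prod_j b j ^+ l j)%R = (t * m).+1.
Proof.
move=> b0 bl; rewrite size_prod => [|j _]; last by rewrite expf_neq0.
have sz j : size (b j ^+ l j)%R = m.+1.
  by rewrite -(bl j) -size_exp prednK // size_poly_gt0 expf_neq0.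
by rewrite (eq_bigr _ (fun j _ => sz j)) sum_nat_const card_ord mulnS -addnS addKn.
Qed.

(** * Cells of the hybrid sequence *)

Section Cells.
Local Open Scope R_scope.
Variables (p s t m : nat) (L : 'I_s -> laurent p) (b : 'I_t -> {poly 'F_p}) (l : 'I_t -> nat).
Hypotheses (p_pr : prime p) (b2 : forall j, (1 < size (b j))%N).
Hypothesis bl : forall j, ((size (b j)).-1 * l j = m)%N.

(** The two kinds of coordinates use different bases and numbers of digits, but by [bl] every axis
    is cut into the same number [p ^ m] of cells. *)
Definition cell (n : nat) (j : 'I_(s + t)) : nat :=
  match split j with
  | inl k => digits_val (fun i => nat_of_ord (kron_digit (L k) n i.+1)) p m
  | inr k => digits_val (fun i => poly_at_p (vdc_digit (b k) n i)) (expn p (size (b k)).-1) (l k)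
  end.

Lemma poly_at_p_vdc_lt k n i : (poly_at_p (vdc_digit (b k) n i) < p ^ (size (b k)).-1)%N.
Proof. by apply: poly_at_p_lt => //; apply: size_vdc_digit. Qed.

Lemma cell_lt n j : (cell n j < p ^ m)%N.
Proof.
rewrite /cell; case: split => k.
  by apply: digits_val_lt => i; apply: ltn_Fp.
by rewrite -(bl k) expnM; apply: digits_val_lt => i; apply: poly_at_p_vdc_lt.
Qed.

Lemma cell_bounds n j :
  INR (cell n j) <= hybrid L b n j * INR (p ^ m)%N <= INR (cell n j) + 1.
Proof.
rewrite /cell /hybrid; case: split => k; first exact: kron_bounds.
by rewrite -(bl k) expnM; apply: vdc_bounds.
Qed.

Lemma cell_eq_kron n n' k i : cell n =1 cell n' -> (i < m)%N ->
  polyL_mul (digit_poly p n - digit_poly p n')%R (L k) (Z.of_nat i.+1) = 0%R.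
Proof.
move=> E im; have := E (unsplit (inl k)); rewrite /cell unsplitK.
move=> /digits_val_inj H; have /val_inj := H (fun _ => ltn_Fp p_pr _) (fun _ => ltn_Fp p_pr _) i im.
by rewrite polyL_mulB /kron_digit => ->; rewrite GRing.subrr.
Qed.

(** Equal cells have equal integer digits, and [poly_at_p] is injective in degree below that of
    [b k], so the digits in base [b k] agree as polynomials. *)
Lemma cell_eq_vdc n n' k : cell n =1 cell n' ->
  (b k ^+ l k %| digit_poly p n - digit_poly p n')%R.
Proof.
move=> E; have := E (unsplit (inr k)); rewrite /cell unsplitK.
move=> /digits_val_inj H; apply: modp_dvdp_exp => i il.
apply: (poly_at_p_inj p_pr (size_vdc_digit n i p_pr (b2 k)) (size_vdc_digit n' i p_pr (b2 k))).
by apply: (H _ _ i il) => ?; apply: poly_at_p_vdc_lt.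
Qed.
End Cells.

Theorem theorem1 (p s t : nat) (L : 'I_s -> laurent p) (b : 'I_t -> {poly 'F_p}) :
  prime p ->
  (forall j, b j \is monic) ->
  (forall j, leq 2 (size (b j))) ->
  (forall i j, i != j -> coprimep (b i) (b j)) ->
  (forall k, is_laurent (L k)) ->
  lin_indep_1L L ->
  uniformly_distributed (hybrid L b).
Proof.
move=> p_pr _ b2 bc Llau Lind; apply: uniformly_distributed_of_grids => Q0.
have p1 := prime_gt1 p_pr; have p0 := prime_gt0 p_pr.
pose e j := (size (b j)).-1.
have e0 j : (0 < e j)%N by rewrite /e; have := b2 j; case: size => // -[].
have b0 j : b j != 0%R by rewrite -size_poly_gt0; apply: ltnW.
(* The product makes [m] divisible by every degree; the factor [Q0.+1] makes [p ^ m] exceed [Q0]. *)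
pose m := (Q0.+1 * \prod_j e j)%N.
have Qm : (Q0 < m)%N by rewrite -[Q0.+1]muln1 leq_pmul2l // prodn_gt0.
pose l j := (m %/ e j)%N.
have bl j : ((size (b j)).-1 * l j = m)%N.
  by rewrite mulnC divnK // dvdn_mull // (bigD1 j) //= dvdn_mulr.
pose B := (\prod_j b j ^+ l j)%R.
have B0 : B != 0%R by apply/prodf_neq0 => j _; rewrite expf_neq0.
have [M full] := digit_mx_full p_pr m Llau Lind B0.
(* This makes the truncated subtraction in [p ^ (M - s * m)] exact, so that fibre bound times number
   of cells is the block length. *)
have smM : (s * m <= M)%N by rewrite -(eqP full) rank_leq_row.
exists (p ^ m)%N, (p ^ (M + t * m))%N, (p ^ (M - s * m))%N.
exists (fun n => [ffun j => Ordinal (cell_lt L p_pr b2 bl n j)]); split.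
- by apply: ltn_trans Qm _; apply: ltn_expl.
- by rewrite expn_gt0 p0.
- by rewrite -expnM -expnD; congr (p ^ _)%N; rewrite mulnDr addnA ![(m * _)%N]mulnC subnK.
- by move=> n j; rewrite ffunE; apply: cell_bounds.
move=> k w; apply: (card_block_le (k := k) p_pr B0 full (size_prod_exp b0 bl)) => r r'.
rewrite !inE => /eqP Er /eqP Er'.
have E : cell m L b l (k * p ^ (M + t * m) + r)%N =1 cell m L b l (k * p ^ (M + t * m) + r')%N.
  by move=> j; have /ffunP/(_ j)/(f_equal val) := etrans Er (esym Er'); rewrite !ffunE.
split; last by move=> i x; apply: (cell_eq_kron p_pr i E).
apply: dvdp_prod_coprime => [i j ij|j]; last exact: cell_eq_vdc E.
by rewrite coprimep_expl // coprimep_expr // bc.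
Qed.
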